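(* Let $h\in\mathbb R\setminus\{0\}$ and let $\{g_n^{(h)}(y)\}_{n\in\mathbb N_0}$ be the deformed Mittag--Leffler polynomials. Then $$g_{n}^{(h)}(y+h)-g_{n}^{(h)}(y)=h\bigl(g_{n-1}^{(h)}(y+h)+g_{n-1}^{(h)}(y)\bigr)\qquad (n\in\mathbb N).$$
   Context: $\mathbb N=\{1,2,\dots\}$ and $\mathbb N_0=\mathbb N\cup\{0\}$. For $h\in\mathbb R\setminus\{0\}$, the deformed exponential function is $e_h(x,y)=(1+hx)^{y/h}$, where $y\in\mathbb R$; thus $e_{-h}(x,y)=(1-hx)^{-y/h}$. The deformed Mittag--Leffler polynomials $g_n^{(h)}(y)$, $n\in\mathbb N_0$, are defined as the coefficients in the expansion $$G_h(x,y)=e_h(x,y)\,e_{-h}(x,y)=(1+hx)^{y/h}(1-hx)^{-y/h}=\sum_{n=0}^\infty g_n^{(h)}(y)\,x^n\qquad(|hx|<1).$$ Each $g_n^{(h)}(y)$ is a polynomial in $y$. *)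

(* Defs.v *)
(* Classical real numbers (Stdlib) with Coquelicot. *)
From Stdlib Require Import Reals.
From Coquelicot Require Import Coquelicot.
Open Scope R_scope.

(* [Rpower a b] is [exp (b * ln a)], the real power for [a > 0]; it is only
   used below where [Rabs (h * x) < 1], so the bases [1 + h * x] and
   [1 - h * x] are positive. *)
Definition deformed_exp (h x y : R) : R := Rpower (1 + h * x) (y / h).

Definition deformed_ML_genfun (h x y : R) : R :=
  deformed_exp h x y * deformed_exp (- h) x y.

(* Since the expansion holds on a neighbourhood of [x = 0], it determines
   every [g n y] uniquely. *)
Definition is_deformed_ML (h : R) (g : nat -> R -> R) : Prop :=
  forall x y : R, Rabs (h * x) < 1 ->
    is_pseries (fun n => g n y) x (deformed_ML_genfun h x y).

(* Main.v *)
(** Since [e_h(x, y + h) = (1 + h x) e_h(x, y)] and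
    [e_{-h}(x, y + h) = e_{-h}(x, y) / (1 - h x)], the generating function
    satisfies [(1 - h x) G_h(x, y + h) = (1 + h x) G_h(x, y)] for [|h x| < 1];
    the theorem is the comparison of the coefficients of [x^n]. *)

Require Import Defs.
From Stdlib Require Import Reals Lra.
From Coquelicot Require Import Coquelicot.
Open Scope R_scope.

(** The terms of a convergent series tend to 0, whereas beyond the radius of convergence they do
    not. *)
Lemma CV_radius_ge_of_ex_pseries (a : nat -> R) (x : R) :
  ex_pseries a x -> Rbar_le (Rabs x) (CV_radius a).
Proof.
  intros Ha.
  apply Rbar_not_lt_le; intros Hlt.
  apply (CV_disk_outside a x Hlt).
  apply ex_series_lim_0.
  apply (ex_series_ext (fun n => scal (pow_n x n) (a n))).
  - intros n. rewrite pow_n_pow. apply Rmult_comm.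
  - exact Ha.
Qed.

(** Convergence at the single nonzero point [r / 2] makes both radii positive; the two sums agree
    near 0, so the coefficients do too. *)
Lemma is_pseries_unique_coef (a b : nat -> R) (f : R -> R) (r : R) :
  0 < r ->
  (forall x, Rabs x < r -> is_pseries a x (f x)) ->
  (forall x, Rabs x < r -> is_pseries b x (f x)) ->
  forall n, a n = b n.
Proof.
  intros Hr Ha Hb n.
  assert (Hr2 : Rabs (r / 2) < r) by (rewrite Rabs_pos_eq; lra).
  assert (Hpos : forall c, ex_pseries c (r / 2) -> Rbar_lt 0 (CV_radius c)).
  { intros c Hc.
    apply Rbar_lt_le_trans with (Rabs (r / 2)).
    - simpl. rewrite Rabs_pos_eq; lra.
    - now apply CV_radius_ge_of_ex_pseries. }
  apply PSeries_ext_recip.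
  - apply Hpos. exists (f (r / 2)). now apply Ha.
  - apply Hpos. exists (f (r / 2)). now apply Hb.
  - exists (mkposreal r Hr). intros x Hx.
    assert (Hxr : Rabs x < r).
    { rewrite <- (Rminus_0_r x). exact Hx. }
    rewrite (is_pseries_unique _ _ _ (Ha x Hxr)).
    now rewrite (is_pseries_unique _ _ _ (Hb x Hxr)).
Qed.

(** [PS_incr_1] shifts the coefficients up by one place, which multiplies the sum by [x]. The cases
    [c = h] and [c = - h] serve the two sides of the functional equation. *)
Lemma is_pseries_mul_affine (a : nat -> R) (c x l : R) :
  is_pseries a x l ->
  is_pseries (PS_plus a (PS_scal c (PS_incr_1 a))) x ((1 + c * x) * l).
Proof.
  intros Ha.
  replace ((1 + c * x) * l) with (l + c * (x * l)) by ring.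
  apply (@is_pseries_plus R_AbsRing R_NormedModule); [exact Ha |].
  apply (@is_pseries_scal R_AbsRing R_NormedModule); [apply Rmult_comm |].
  now apply (@is_pseries_incr_1 R_AbsRing R_NormedModule).
Qed.

Lemma deformed_exp_shift (h x y : R) :
  h <> 0 -> 0 < 1 + h * x ->
  deformed_exp h x (y + h) = (1 + h * x) * deformed_exp h x y.
Proof.
  intros hh Hx. unfold deformed_exp.
  replace ((y + h) / h) with (1 + y / h) by (field; exact hh).
  now rewrite Rpower_plus, Rpower_1.
Qed.

Lemma deformed_ML_genfun_shift (h x y : R) :
  h <> 0 -> Rabs (h * x) < 1 ->
  (1 + - h * x) * deformed_ML_genfun h x (y + h) =
  (1 + h * x) * deformed_ML_genfun h x y.
Proof.
  intros hh Hx. apply Rabs_def2 in Hx.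
  (* The shift rule for the parameter [- h], started at [y + h]: since [(y + h) + - h = y], no
     division by [1 - h * x] arises. *)
  assert (Hneg : deformed_exp (- h) x y =
                 (1 + - h * x) * deformed_exp (- h) x (y + h)).
  { rewrite <- deformed_exp_shift by lra. f_equal. ring. }
  unfold deformed_ML_genfun.
  rewrite Hneg, deformed_exp_shift by lra. ring.
Qed.

Theorem theorem2p2 (h : R) (hh : h <> 0) (g : nat -> R -> R)
  (hg : is_deformed_ML h g) (n : nat) (hn : (1 <= n)%nat) (y : R) :
  g n (y + h) - g n y = h * (g (n - 1)%nat (y + h) + g (n - 1)%nat y).
Proof.
  (* The expansion is available exactly for [Rabs x < / Rabs h]. *)
  assert (Hr : 0 < / Rabs h) by (now apply Rinv_0_lt_compat, Rabs_pos_lt).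
  assert (Hdisk : forall x, Rabs x < / Rabs h -> Rabs (h * x) < 1).
  { intros x Hx. rewrite Rabs_mult.
    rewrite <- (Rinv_r (Rabs h)) by (now apply Rabs_no_R0).
    apply Rmult_lt_compat_l; [now apply Rabs_pos_lt | exact Hx]. }
  assert (Hcoef := is_pseries_unique_coef
    (PS_plus (fun k => g k (y + h))
       (PS_scal (- h) (PS_incr_1 (fun k => g k (y + h)))))
    (PS_plus (fun k => g k y) (PS_scal h (PS_incr_1 (fun k => g k y))))
    (fun x => (1 + h * x) * deformed_ML_genfun h x y) (/ Rabs h) Hr).
  destruct n as [|n]; [now inversion hn |].
  (* At the successor index [S n], the shifted series contributes its coefficient of index [n], so
     this is [Hcoef] by computation. *)
  assert (Hn : g (S n) (y + h) + - h * g n (y + h) = g (S n) y + h * g n y).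
  { apply (fun Ha Hb => Hcoef Ha Hb (S n)); intros x Hx; apply Hdisk in Hx.
    (* The functional equation turns the common sum into [(1 + - h * x) * deformed_ML_genfun h x (y
       + h)]. *)
    - rewrite <- deformed_ML_genfun_shift by assumption.
      apply is_pseries_mul_affine, hg, Hx.
    - apply is_pseries_mul_affine, hg, Hx. }
  replace (S n - 1)%nat with n by (simpl; now rewrite Nat.sub_0_r).
  lra.
Qed.
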